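(* Let $X$ be a uniformly smooth (real) Banach space with modulus of smoothness $\rho(u)$, and let $\mathcal D$ be a dictionary in $X$. Let $\tau=\{t_m\}_{m=1}^\infty$, $t_m\in[0,1]$, be a weakness sequence such that for every $\theta\in(0,1/2]$ $$\sum_{m=1}^\infty t_m\,\xi_m(\rho,\tau,\theta)=\infty .$$ Then any algorithm from the class $\mathcal{WBGA}$ with the weakness sequence $\tau$ converges for any target element $f\in X$, i.e. its remainders satisfy $\lim_{m\to\infty}\|f_m\|=0$.
   Context: A dictionary in a real Banach space $X$ is a set $\mathcal D\subset X$ such that $\|g\|\le 1$ for all $g\in\mathcal D$, the closed linear span of $\mathcal D$ is $X$, and $g\in\mathcal D$ implies $-g\in\mathcal D$. For a nonzero $h\in X$, $F_h$ denotes a norming functional of $h$: $F_h\in X'$, $\|F_h\|=1$, $F_h(h)=\|h\|$ (unique when $X$ is uniformly smooth). For $F\in X'$, $\|F\|_{\mathcal D}:=\sup_{g\in\mathcal D}F(g)$. The modulus of smoothness is $\rho(u)=\sup_{\|x\|=\|y\|=1}\frac{\|x+uy\|+\|x-uy\|}{2}-1$; $X$ is uniformly smooth if $\lim_{u\to0}\rho(u)/u=0$. For $0<\theta\le 1/2$, $\xi_m(\rho,\tau,\theta)$ is the root $u=\xi_m\in(0,2]$ of the equation $\rho(u)=\theta t_m u$ (it is unique when $t_m>0$; when $t_m=0$ the product $t_m\xi_m$ is $0$). An algorithm from the class $\mathcal{WBGA}$ (Weak Biorthogonal Greedy Algorithms) with weakness sequence $\tau=\{t_m\}_{m\ge1}$,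 applied to a target $f\in X$, produces elements $\varphi_m\in\mathcal D$ ($m\ge1$), approximants $G_m\in\operatorname{span}\{\varphi_1,\dots,\varphi_m\}$ with $G_0=0$, and remainders $f_m=f-G_m$ ($f_0=f$), such that for every $m\ge1$: (1) $F_{f_{m-1}}(\varphi_m)\ge t_m\|F_{f_{m-1}}\|_{\mathcal D}$; (2) $\|f_m\|\le\inf_{\lambda\ge0}\|f_{m-1}-\lambda\varphi_m\|$; (3) $F_{f_m}(G_m)=0$. Conditions involving $F_{f_k}$ are required only when $f_k\ne0$. *)

(* Defs.v *)
From HB Require Import structures.
From mathcomp Require Import all_boot all_order all_algebra.
From mathcomp Require Import all_classical all_reals all_analysis.

Set Implicit Arguments.
Unset Strict Implicit.
Unset Printing Implicit Defensive.

Import Order.TTheory GRing.Theory Num.Theory.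
Import numFieldNormedType.Exports.

Local Open Scope classical_set_scope.
Local Open Scope ring_scope.

Section smoothness.
Context {R : realType} (X : completeNormedModType R).

(* The set is bounded above by `|u|, so that the real-valued sup is the
   genuine supremum; in the zero space it is empty and the value is 0. *)
Definition modulus_of_smoothness (u : R) : R :=
  sup [set z | exists x y : X, [/\ `|x| = 1, `|y| = 1 &
    z = (`|x + u *: y| + `|x - u *: y|) / 2 - 1]].

Definition uniformly_smooth :=
  modulus_of_smoothness u / u @[u --> 0^'] --> 0.

End smoothness.

(* The root u in (0, 2] of rho u = theta * t_m * u. If there is none (which for
   a nonzero uniformly smooth space can only happen when t_m = 0) the value
   is 0; when t_m = 0 the product t_m * xi_m vanishes whatever the value is. *)
Definition xi_root {R : realType} (rho : R -> R) (t : nat -> R) (theta : R)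
    (m : nat) : R :=
  xget 0 [set u | 0 < u <= 2 /\ rho u = theta * t m * u].

Section dictionary.
Context {R : realType} {X : completeNormedModType R}.

Definition lin_span (A : set X) : set X :=
  [set x | exists (n : nat) (a : 'I_n -> R) (g : 'I_n -> X),
    (forall i, A (g i)) /\ x = \sum_(i < n) a i *: g i].

Definition dictionary (D : set X) : Prop :=
  [/\ forall g, D g -> `|g| <= 1,
      closure (lin_span D) = setT &
      forall g, D g -> D (- g)].

Definition dual_norm (F : X -> R) : R :=
  sup [set `|F x| | x in [set x : X | `|x| <= 1]].

Definition norming_functional (h : X) (F : {linear X -> R^o}) : Prop :=
  [/\ continuous F, dual_norm F = 1 & F h = `|h|].

Definition dict_norm (D : set X) (F : X -> R) : R :=
  sup [set F g | g in D].

(* phi and G (with remainders f_m = f - G m) are the output of some algorithm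
   from the class WBGA applied to f; F h is the norming functional F_h, t m and
   phi m are used for m >= 1 only. *)
Definition is_WBGA (F : X -> {linear X -> R^o}) (D : set X) (t : nat -> R)
    (f : X) (phi G : nat -> X) : Prop :=
  let r m := f - G m in
  [/\ G 0%N = 0,
      forall m, (1 <= m)%N ->
        D (phi m) /\ lin_span [set phi k | k in [set k | (1 <= k <= m)%N]] (G m),
      forall m, (1 <= m)%N -> r m.-1 != 0 ->
        t m * dict_norm D (F (r m.-1)) <= F (r m.-1) (phi m),
      forall m, (1 <= m)%N ->
        `|r m| <= inf [set `|r m.-1 - lambda *: phi m| |
                        lambda in [set lambda : R | 0 <= lambda]] &
      forall m, (1 <= m)%N -> r m != 0 -> F (r m) (G m) = 0].

End dictionary.

(* Main.v *)
(* If the remainders f_m do not tend to 0, their norms decrease to some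
   alpha > 0.  Approximating f within alpha / 2 by a combination of D whose
   coefficients have absolute sum A, and using F_{f_m}(G_m) = 0, one gets
   ||F_{f_m}||_D >= alpha / (2 A).  Smoothness bounds ||f_{m-1} - l phi_m|| by
   ||f_{m-1}|| (1 + 2 rho(l / ||f_{m-1}||)) - l F_{f_{m-1}}(phi_m); the choice
   l = ||f_{m-1}|| xi_m with theta <= alpha / (8 A) makes the m-th step decrease
   the norm by at least alpha^2 / (4 A) * t_m xi_m, and these decrements are not
   summable. *)

Require Import Defs.
From HB Require Import structures.
From mathcomp Require Import all_boot all_order all_algebra.
From mathcomp Require Import all_classical all_reals all_analysis.
From mathcomp Require Import ring lra.

Set Implicit Arguments.
Unset Strict Implicit.
Unset Printing Implicit Defensive.

Import Order.TTheory GRing.Theory Num.Theory.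
Import numFieldNormedType.Exports.

Local Open Scope classical_set_scope.
Local Open Scope ring_scope.

Section modulus.
Context {R : realType} (X : completeNormedModType R).

Lemma modulus_of_smoothness_ge (u : R) (x y : X) : `|x| = 1 -> `|y| = 1 ->
  (`|x + u *: y| + `|x - u *: y|) / 2 - 1 <= modulus_of_smoothness X u.
Proof.
move=> x1 y1; apply: ub_le_sup; last by exists x, y.
exists `|u| => _ [x' [y' [x'1 y'1 ->]]].
have := ler_normD x' (u *: y'); have := ler_normB x' (u *: y').
rewrite normrZ x'1 y'1; lra.
Qed.

(* The left-hand side is even and convex in s. *)
Lemma normDB_homo (x y : X) (s r : R) : 0 <= s <= r ->
  `|x + s *: y| + `|x - s *: y| <= `|x + r *: y| + `|x - r *: y|.
Proof.
move=> /andP[s0 sr].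
have [r0|r_le0] := ltP 0 r; last by have -> : s = r by lra.
pose p : R := (1 + s / r) / 2; pose q : R := (1 - s / r) / 2.
have sr1 : s / r <= 1 by rewrite ler_pdivrMr // mul1r.
have sr0 : 0 <= s / r by rewrite divr_ge0 // ltW.
have p0 : 0 <= p by rewrite /p; lra.
have q0 : 0 <= q by rewrite /q; lra.
have pq1 : p + q = 1 by rewrite /p /q; lra.
have pqr : p * r - q * r = s by rewrite /p /q; field; rewrite gt_eqF.
clearbody p q.
have xsy : x + s *: y = p *: (x + r *: y) + q *: (x - r *: y).
  rewrite scalerDr scalerBr addrACA -scalerDl pq1 scale1r.
  by rewrite !scalerA -scalerBl pqr.
have xNsy : x - s *: y = q *: (x + r *: y) + p *: (x - r *: y).
  rewrite scalerDr scalerBr addrACA -scalerDl (addrC q) pq1 scale1r.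
  by rewrite !scalerA -scalerBl -pqr -scaleNr opprB.
have := ler_normD (p *: (x + r *: y)) (q *: (x - r *: y)).
have := ler_normD (q *: (x + r *: y)) (p *: (x - r *: y)).
rewrite -xsy -xNsy !normrZ (ger0_norm p0) (ger0_norm q0).
have -> : q = 1 - p by lra.
nra.
Qed.

(** Dividing by [|x|] reduces to a unit vector [e]. Writing [y] as [|y|] times a unit vector turns
    the step [u] into [|y| * u <= u], which [normDB_homo] allows one to enlarge to [u]. *)
Lemma normDB_le_modulus (x y : X) (u : R) : x != 0 -> `|y| <= 1 -> 0 <= u ->
  `|x + (`|x| * u) *: y| + `|x - (`|x| * u) *: y| <=
  2 * `|x| * (1 + modulus_of_smoothness X u).
Proof.
move=> x0 y1 u0; have nx0 : 0 < `|x| by rewrite normr_gt0.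
set e := `|x|^-1 *: x.
have e1 : `|e| = 1 by rewrite normrZ normfV normr_id mulVf // gt_eqF.
have xe : x = `|x| *: e by rewrite scalerA divff ?scale1r // gt_eqF.
have scaled (v : X) : `|x + (`|x| * u) *: v| + `|x - (`|x| * u) *: v| =
    `|x| * (`|e + u *: v| + `|e - u *: v|).
  have {1 3}-> : x = `|x| *: e := xe.
  by rewrite -!scalerA -scalerDr -scalerBr !normrZ normr_id mulrDr.
have [y' y'1 ->] : exists2 y' : X, `|y'| = 1 & y = `|y| *: y'.
  have [->|y0] := eqVneq y 0; first by exists e; rewrite // normr0 scale0r.
  exists (`|y|^-1 *: y); first by rewrite normrZ normfV normr_id mulVf ?normr_eq0.
  by rewrite scalerA divff ?scale1r ?normr_eq0.
rewrite scaled -mulrA mulrCA ler_pM2l // scalerA.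
apply: (@le_trans _ _ (`|e + u *: y'| + `|e - u *: y'|)).
  by apply: normDB_homo; rewrite mulr_ge0 //= ler_piMr.
have := modulus_of_smoothness_ge u e1 y'1; lra.
Qed.

End modulus.

Section functionals.
Context {R : realType} {X : completeNormedModType R}.
Implicit Types (D : set X) (F : {linear X -> R^o}).

Lemma norming_functional_le (h x : X) F : norming_functional h F -> F x <= `|x|.
Proof.
move=> [_ F1 _]; have [->|x0] := eqVneq x 0; first by rewrite linear0 normr0.
have nx0 : 0 < `|x| by rewrite normr_gt0.
(* A set without a supremum gets the value 0 from [sup], so [dual_norm F = 1] already certifies that
   [F] is bounded on the unit ball. *)
have supF : has_sup [set `|F z| | z in [set z : X | `|z| <= 1]].
  apply: contrapT => /sup_out; rewrite -/(dual_norm F) F1.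
  by move/eqP; rewrite oner_eq0.
have : `|F (`|x|^-1 *: x)| <= 1.
  rewrite -[leRHS]F1; apply: (ub_le_sup supF.2).
  by exists (`|x|^-1 *: x) => //=; rewrite normrZ normfV normr_id mulVf ?gt_eqF.
rewrite linearZ /= normrZ normfV normr_id mulrC ler_pdivrMr // mul1r.
exact/le_trans/ler_norm.
Qed.

(** By the symmetry of [D], a negative coefficient moves its sign onto the element: [a i *: g i] is
    [|a i|] times [- g i], which is again in [D]. *)
Lemma norming_lin_comb_le D (h : X) F n (a : 'I_n -> R) (g : 'I_n -> X) :
  dictionary D -> norming_functional h F -> (forall i, D (g i)) ->
  F (\sum_(i < n) a i *: g i) <= (\sum_(i < n) `|a i|) * dict_norm D F.
Proof.
move=> [D1 _ DN] nF Dg; have le_dict z : D z -> F z <= dict_norm D F.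
  move=> Dz; apply: ub_le_sup; last by exists z.
  exists 1 => _ [w Dw <-].
  exact: le_trans (norming_functional_le w nF) (D1 _ Dw).
rewrite linear_sum mulr_suml; apply: ler_sum => i _; rewrite linearZ /=.
have [a0|a0] := leP 0 (a i).
  by rewrite ger0_norm //; apply: ler_wpM2l => //; exact: le_dict.
rewrite ltr0_norm // -[X in X <= _]mulrNN -[- F (g i)]linearN.
by apply: ler_wpM2l; [rewrite oppr_ge0 ltW | exact/le_dict/DN].
Qed.

Lemma dictionary_approx D (f : X) (e : R) : dictionary D -> 0 < e ->
  exists n (a : 'I_n -> R) (g : 'I_n -> X),
    (forall i, D (g i)) /\ `|f - \sum_(i < n) a i *: g i| < e.
Proof.
move=> [_ clD _] e0.
have : closure (lin_span D) f by rewrite clD.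
move=> /(_ _ (nbhsx_ballx f e e0))[_ [[n [a [g [Dg ->]]]]]].
by rewrite -ball_normE /= => fe; exists n, a, g.
Qed.

End functionals.

Lemma xi_root_ge0 {R : realType} (rho : R -> R) t theta m :
  0 <= xi_root rho t theta m.
Proof. by rewrite /xi_root; case: xgetP => // u _ [/andP[/ltW]]. Qed.

(** A nonzero value cannot be the default 0 of [xget], so it is a true root. *)
Lemma xi_rootP {R : realType} (rho : R -> R) t theta m :
  xi_root rho t theta m != 0 ->
  rho (xi_root rho t theta m) = theta * t m * xi_root rho t theta m.
Proof.
by rewrite /xi_root; case: xgetP => [u -> [_ ->]//|_]; rewrite eqxx.
Qed.

(** The partial sums telescope and stay below [u 0 - b]. *)
Lemma nneseries_neq_pinfty {R : realType} (u x : nat -> R) (b : R) :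
  (forall m, b <= u m) ->
  (forall m, (1 <= m)%N -> 0 <= x m <= u m.-1 - u m) ->
  (\sum_(1 <= m <oo) (x m)%:E)%E <> +oo%E.
Proof.
move=> bu xu sumx.
have : (\sum_(1 <= m <oo) (x m)%:E <= (u 0%N - b)%:E)%E.
  apply: lime_le.
    by apply: is_cvg_nneseries => m m1 _; rewrite lee_fin; case/andP: (xu m m1).
  apply: nearW => n; rewrite sumEFin lee_fin.
  case: n => [|n]; first by rewrite big_geq // subr_ge0.
  apply: (@le_trans _ _ (u 0%N - u n)); last by rewrite lerD2l lerN2.
  elim: n => [|n IHn]; first by rewrite big_geq // subrr.
  rewrite big_nat_recr //=; have /andP[_] := xu n.+1 isT.
  by move=> /=; lra.
by rewrite sumx leye_eq.
Qed.

Theorem theorem5p1 (R : realType) (X : completeNormedModType R)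
  (smoothX : uniformly_smooth X)
  (D : set X) (dictD : dictionary D)
  (F : X -> {linear X -> R^o})
  (normingF : forall h : X, h != 0 -> norming_functional h (F h))
  (t : nat -> R) (t01 : forall m : nat, (1 <= m)%N -> 0 <= t m <= 1)
  (divt : forall theta : R, 0 < theta <= 1 / 2 ->
    (\sum_(1 <= m <oo)
      (t m * xi_root (modulus_of_smoothness X) t theta m)%:E = +oo)%E)
  (f : X) (phi G : nat -> X) (algo : is_WBGA F D t f phi G) :
  `|f - G m| @[m --> \oo] --> (0 : R).
Proof.
case: algo => G0 phiG greedy best biorth.
set r := fun m => f - G m.
have r_le m (l : R) : 0 <= l -> `|r m.+1| <= `|r m - l *: phi m.+1|.
  move=> l0; apply: (le_trans (best m.+1 isT)); apply: ge_inf; last by exists l.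
  by exists 0 => _ [l' _ <-].
(* The choice [l = 0] is admissible in [r_le]. *)
have r_noninc : nonincreasing_seq (fun m => `|r m|).
  apply/nonincreasing_seqP => m.
  by have := r_le m 0 (lexx 0); rewrite scale0r subr0.
have r_lb : has_lbound (range (fun m => `|r m|)) by exists 0 => _ [m _ <-].
have := nonincreasing_cvgn r_noninc r_lb.
set alpha := inf _ => r_cvg.
have alpha_le m : alpha <= `|r m| by apply: ge_inf => //; exists m.
have [alpha_gt0|alpha_le0] := ltP 0 alpha; last first.
  suff <- : alpha = 0 by [].
  apply/eqP; rewrite eq_le alpha_le0 /=; apply: lb_le_inf.
    by exists `|r 0%N|, 0%N.
  by move=> _ [m _ <-].
have r_neq0 m : r m != 0 by rewrite -normr_gt0 (lt_le_trans alpha_gt0).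
have [|n [a [g [Dg]]]] := @dictionary_approx _ _ D f (alpha / 2) dictD.
  by rewrite divr_gt0.
set h := \sum_(i < n) _ => fh.
pose A : R := \sum_(i < n) `|a i|.
have dict_ge m : alpha / 2 <= A * dict_norm D (F (r m)).
  have nF := normingF _ (r_neq0 m).
  (* Biorthogonality is given from index 1 on; at index 0 it holds because [G 0] is zero. *)
  have FG : F (r m) (G m) = 0.
    by case: m {nF} => [|m]; [rewrite G0 linear0 | exact: (biorth m.+1 isT (r_neq0 m.+1))].
  have Fr : F (r m) (r m) = `|r m| by case: nF.
  have Ff : F (r m) f = `|r m| by rewrite -Fr linearB /= FG subr0.
  have := norming_functional_le (f - h) nF; rewrite linearB /= Ff.
  have := norming_lin_comb_le a dictD nF Dg; rewrite -/h -/A.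
  by have := alpha_le m; lra.
have A_ge0 : 0 <= A by exact: sumr_ge0.
have A_gt0 : 0 < A.
  rewrite lt0r A_ge0 andbT; apply/eqP => A0.
  by have := dict_ge 0%N; rewrite A0 mul0r; lra.
pose B : R := alpha / A.
have B_gt0 : 0 < B by rewrite divr_gt0.
(* The gain from the functional is at least [|r m| * B / 2] times [t * xi], since [dict_norm] is at
   least [B / 2]. The bound [B / 8] keeps the smoothness loss, [2 * |r m| * theta] times [t * xi],
   within half of that gain. *)
pose theta := Num.min (1 / 2) (B / 8).
have theta_bnd : 0 < theta <= 1 / 2.
  by rewrite lt_min ge_min lexx /= !divr_gt0.
have theta_le : theta <= B / 8 by rewrite ge_min lexx orbT.
set rho := modulus_of_smoothness X in divt *.
set x := fun m => t m * xi_root rho t theta m.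
have x_ge0 m : (1 <= m)%N -> 0 <= x m.
  by move=> m1; rewrite mulr_ge0 ?xi_root_ge0 //; case/andP: (t01 m m1).
have r_decr m : (1 <= m)%N -> `|r m| <= `|r m.-1| - alpha * B / 4 * x m.
  case: m => // m _ /=; have := x_ge0 m.+1 isT; rewrite /x.
  set xi := xi_root _ _ _ _ => x0.
  (* Without a root the claimed decrease is 0, and monotonicity suffices. *)
  have [xi0|xi_neq0] := eqVneq xi 0.
    by rewrite xi0 !mulr0 subr0; apply: r_noninc.
  have rho_xi := xi_rootP xi_neq0; rewrite -/xi in rho_xi.
  have xi_ge0 : 0 <= xi := xi_root_ge0 _ _ _ _.
  have nF := normingF _ (r_neq0 m).
  have Fr : F (r m) (r m) = `|r m| by case: nF.
  have [Dphi _] := phiG m.+1 isT.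
  have phi1 : `|phi m.+1| <= 1 by case: dictD => + _ _; exact.
  set l := `|r m| * xi.
  have l0 : 0 <= l by rewrite mulr_ge0.
  have := normDB_le_modulus (r_neq0 m) phi1 xi_ge0.
  rewrite -/rho rho_xi -/l => smooth.
  (* The lower bound on the norm of [r m + l *: phi m.+1] turns the smoothness bound on the sum of
     both norms into an upper bound on that of [r m - l *: phi m.+1]. *)
  have := norming_functional_le (r m + l *: phi m.+1) nF.
  rewrite linearD linearZ /= Fr => lower.
  have dictB : B / 2 <= dict_norm D (F (r m)).
    by rewrite /B mulrAC ler_pdivrMr // (mulrC _ A).
  have t0 : 0 <= t m.+1 by case/andP: (t01 m.+1 isT).
  have Fphi : t m.+1 * (B / 2) <= F (r m) (phi m.+1).
    exact: le_trans (ler_wpM2l t0 dictB) (greedy m.+1 isT (r_neq0 m)).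
  have lFphi := ler_wpM2l l0 Fphi.
  have upper := r_le m l l0.
  set y := t m.+1 * xi in x0 *.
  have theta_y : theta * y <= B / 8 * y by rewrite ler_wpM2r.
  have By_ge0 : 0 <= B * y by rewrite mulr_ge0 // ltW.
  have r_theta := ler_wpM2l (normr_ge0 (r m)) theta_y.
  have r_alpha := ler_wpM2r By_ge0 (alpha_le m).
  have lFphiE : l * (t m.+1 * (B / 2)) = `|r m| * (B * y) / 2.
    by rewrite /l /y; ring.
  have smoothE : 2 * `|r m| * (1 + theta * t m.+1 * xi) =
      2 * `|r m| + 2 * (`|r m| * (theta * y)) by rewrite /y; ring.
  have scaleE : l *: F (r m) (phi m.+1) = l * F (r m) (phi m.+1) by [].
  rewrite lFphiE in lFphi; rewrite smoothE in smooth.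
  rewrite scaleE in lower; lra.
have c_gt0 : 0 < alpha * B / 4 by rewrite divr_gt0 // mulr_gt0.
(* Dividing the norms by the constant of [r_decr] makes their decrements dominate [x] itself,
   contradicting the divergence hypothesis. *)
have /nneseries_neq_pinfty bounded :
    forall m, 0 <= `|r m| / (alpha * B / 4).
  by move=> m; rewrite divr_ge0 // ltW.
case: (bounded x _ (divt _ theta_bnd)) => m m1.
rewrite x_ge0 //= -mulrBl ler_pdivlMr // mulrC.
by have := r_decr m m1; lra.
Qed.
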